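(* Let $n$ be a positive integer, let $x,y\in\mathbb{B}^n$ be arbitrary and let $w=\frac{|x-y|}{2}e_1$. Then $$u_{\mathbb{B}^n}(x,y)\ge u_{\mathbb{B}^n}(-w,w)=2\log\left(\frac{2+|x-y|}{2-|x-y|}\right)\ge|x-y|,$$ where the first inequality becomes an equality when $y=-x$.
   Context: $|\cdot|$ is the Euclidean norm on $\mathbb{R}^n$, $\mathbb{B}^n=\{x\in\mathbb{R}^n:|x|<1\}$, and $e_1$ is the first standard unit vector of $\mathbb{R}^n$. For a domain $D\subsetneq\mathbb{R}^n$ the $u_D$-metric is $$u_D(x,y)=2\log\frac{|x-y|+\max\{\operatorname{dist}(x,\partial D),\operatorname{dist}(y,\partial D)\}}{\sqrt{\operatorname{dist}(x,\partial D)\,\operatorname{dist}(y,\partial D)}},\quad x,y\in D,$$ where $\operatorname{dist}$ is the Euclidean distance. *)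

(* Defs.v *)
From HB Require Import structures.
From mathcomp Require Import all_boot all_order all_algebra.
From mathcomp Require Import all_classical all_reals all_analysis.
Set Implicit Arguments.
Unset Strict Implicit.
Unset Printing Implicit Defensive.
Import Order.TTheory GRing.Theory Num.Theory.
Import numFieldNormedType.Exports.
Local Open Scope classical_set_scope.
Local Open Scope ring_scope.

(* MathComp-Analysis equips 'rV[R]_n with the sup norm `|_|, which induces the
   usual topology of R^n but is not the Euclidean norm. *)
Definition enorm (R : realType) (n : nat) (x : 'rV[R]_n) : R :=
  Num.sqrt (\sum_(i < n) x ord0 i ^+ 2).

Definition eball (R : realType) (n : nat) : set 'rV[R]_n :=
  [set x | enorm x < 1].
Arguments eball : clear implicits.

(* Meaningful for 0 < n only (for n = 0 it is the null vector of R^0). *)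
Definition e1 (R : realType) (n : nat) : 'rV[R]_n :=
  \row_(i < n) (nat_of_ord i == 0%N)%:R.
Arguments e1 : clear implicits.

Definition frontier (T : topologicalType) (A : set T) : set T :=
  closure A `\` interior A.

(* [inf] is real-valued: this is the distance to A when A is nonempty. *)
Definition dist_to (R : realType) (n : nat) (x : 'rV[R]_n) (A : set 'rV[R]_n) : R :=
  inf [set enorm (x - z) | z in A].

(* The u_D-metric of a domain D strictly included in R^n, at points x, y of D;
   as a total function it takes irrelevant values elsewhere. *)
Definition u_metric (R : realType) (n : nat) (D : set 'rV[R]_n)
    (x y : 'rV[R]_n) : R :=
  let dx := dist_to x (frontier D) in
  let dy := dist_to y (frontier D) in
  2 * ln ((enorm (x - y) + Num.max dx dy) / Num.sqrt (dx * dy)).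

(* Main.v *)
Require Import Defs.
From HB Require Import structures.
From mathcomp Require Import all_boot all_order all_algebra.
From mathcomp Require Import ring lra.
From mathcomp Require Import all_classical all_reals all_analysis.
Set Implicit Arguments.
Unset Strict Implicit.
Unset Printing Implicit Defensive.
Import Order.TTheory GRing.Theory Num.Theory.
Import numFieldNormedType.Exports.
Local Open Scope classical_set_scope.
Local Open Scope ring_scope.

(** The topological boundary of the unit ball is the unit sphere, and the
   distance from a point x of the ball to the sphere is 1 - |x|: the triangle
   inequality gives the lower bound, and the radial projection of x attains it.
   Hence u_B(x, y) only depends on t = |x - y|, a = 1 - |x| and b = 1 - |y|,
   namely u_B(x, y) = 2 log ((t + max a b) / sqrt (a b)).

   Put s = sqrt (a b).  Then s <= max a b, and by the AM-GM and triangle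
   inequalities s <= (a + b) / 2 = 1 - (|x| + |y|) / 2 <= 1 - t / 2.  So
   (t + max a b) / s >= 1 + t / s >= 1 + t / (1 - t / 2) = (2 + t) / (2 - t).
   For antipodal points a = b = 1 - t / 2 and every step is an equality; the
   pair (-w, w) is antipodal with the same t, which gives both the value of
   u_B(-w, w) and the case of equality.  The remaining lower bound
   2 log ((2 + t) / (2 - t)) >= t is log q <= q - 1 at q = (2 - t) / (2 + t),
   because 2 (1 - q) = 4 t / (2 + t) >= t when t <= 2. *)

(** * The Euclidean norm *)

Lemma enorm_ge0 (R : realType) (n : nat) (x : 'rV[R]_n) : 0 <= enorm x.
Proof. exact: sqrtr_ge0. Qed.

Lemma enorm_sqr (R : realType) (n : nat) (x : 'rV[R]_n) :
  enorm x ^+ 2 = \sum_(i < n) x ord0 i ^+ 2.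
Proof. by rewrite sqr_sqrtr // sumr_ge0 // => i _; exact: sqr_ge0. Qed.

Lemma enormZ (R : realType) (n : nat) (a : R) (x : 'rV[R]_n) :
  enorm (a *: x) = `|a| * enorm x.
Proof.
rewrite /enorm -sqrtr_sqr -sqrtrM ?sqr_ge0 // mulr_sumr.
by congr Num.sqrt; apply: eq_bigr => i _; rewrite mxE exprMn.
Qed.

Lemma enormN (R : realType) (n : nat) (x : 'rV[R]_n) : enorm (- x) = enorm x.
Proof. by rewrite -scaleN1r enormZ normrN1 mul1r. Qed.

Lemma enorm_eq0 (R : realType) (n : nat) (x : 'rV[R]_n) :
  enorm x = 0 -> x = 0.
Proof.
move=> x0; have /eqP := enorm_sqr x; rewrite x0 expr0n eq_sym /=.
rewrite psumr_eq0; last by move=> i _; exact: sqr_ge0.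
move=> /allP xi0; apply/rowP => i; rewrite mxE.
have := xi0 i (mem_index_enum i).
by rewrite sqrf_eq0 => /eqP; exact.
Qed.

Lemma enorm_e1 (R : realType) (n : nat) : (0 < n)%N -> enorm (e1 R n) = 1.
Proof.
case: n => // n _; rewrite /enorm (bigD1 ord0) //= big1 => [|i i0].
  by rewrite mxE eqxx expr1n addr0 sqrtr1.
by rewrite mxE (negbTE (i0 : nat_of_ord i != 0%N)) expr0n.
Qed.

(** The square of the norm of |y|^2 x - <x, y> y is
   |y|^2 (|x|^2 |y|^2 - <x, y>^2), and it is nonnegative. *)
Lemma enorm_cauchy_schwarz (R : realType) (n : nat) (x y : 'rV[R]_n) :
  \sum_(i < n) x ord0 i * y ord0 i <= enorm x * enorm y.
Proof.
move CE : (\sum_(i < n) _) => C.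
have [y0|y_neq0] := eqVneq (enorm y) 0.
  rewrite y0 mulr0 -CE big1 // => i _.
  by rewrite (enorm_eq0 y0) mxE mulr0.
have y_gt0 : 0 < enorm y by rewrite lt_neqAle eq_sym y_neq0 enorm_ge0.
have : 0 <= \sum_(i < n) (enorm y ^+ 2 * x ord0 i - C * y ord0 i) ^+ 2.
  by apply: sumr_ge0 => i _; exact: sqr_ge0.
have -> : \sum_(i < n) (enorm y ^+ 2 * x ord0 i - C * y ord0 i) ^+ 2 =
    enorm y ^+ 4 * enorm x ^+ 2 - 2 * enorm y ^+ 2 * C * C
    + C ^+ 2 * enorm y ^+ 2.
  transitivity (enorm y ^+ 4 * (\sum_(i < n) x ord0 i ^+ 2)
      - 2 * enorm y ^+ 2 * C * (\sum_(i < n) x ord0 i * y ord0 i)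
      + C ^+ 2 * (\sum_(i < n) y ord0 i ^+ 2)); last by rewrite -!enorm_sqr CE.
  rewrite !mulr_sumr -sumrB -big_split /=.
  by apply: eq_bigr => i _; ring.
have -> : enorm y ^+ 4 * enorm x ^+ 2 - 2 * enorm y ^+ 2 * C * C
    + C ^+ 2 * enorm y ^+ 2 =
    enorm y ^+ 2 * ((enorm x * enorm y) ^+ 2 - C ^+ 2) by ring.
rewrite pmulr_rge0 ?exprn_gt0 // subr_ge0 => leC.
apply: le_trans (ler_norm C) _.
rewrite -(@ler_pXn2r _ 2) ?nnegrE ?mulr_ge0 ?enorm_ge0 //.
by rewrite -normrX ger0_norm ?sqr_ge0.
Qed.

Lemma ler_enormD (R : realType) (n : nat) (x y : 'rV[R]_n) :
  enorm (x + y) <= enorm x + enorm y.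
Proof.
rewrite -(@ler_pXn2r _ 2) ?nnegrE ?addr_ge0 ?enorm_ge0 //.
have -> : enorm (x + y) ^+ 2 =
    enorm x ^+ 2 + 2 * (\sum_(i < n) x ord0 i * y ord0 i) + enorm y ^+ 2.
  rewrite !enorm_sqr mulr_sumr -!big_split /=.
  by apply: eq_bigr => i _; rewrite mxE; ring.
by have := enorm_cauchy_schwarz x y; nra.
Qed.

Lemma ler_enormB (R : realType) (n : nat) (x y : 'rV[R]_n) :
  enorm (x - y) <= enorm x + enorm y.
Proof. by rewrite -(enormN y) ler_enormD. Qed.

Lemma lerB_enorm (R : realType) (n : nat) (x y : 'rV[R]_n) :
  enorm y - enorm x <= enorm (x - y).
Proof.
rewrite lerBlDl -(enormN (x - y)) opprB.
by have := ler_enormD x (y - x); rewrite addrC subrK.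
Qed.

Lemma enorm_continuous (R : realType) (n : nat) :
  continuous (fun x : 'rV[R]_n => enorm x).
Proof.
have sqr_continuous : continuous
    (fun v : 'rV[R]_n => \sum_(i < n) v ord0 i ^+ 2).
  apply: continuous_big => [|i _ v]; first exact: add_continuous.
  apply: (@continuous_comp _ _ _ (fun u : 'rV[R]_n => u ord0 i)
    (fun r : R => r ^+ 2)).
    exact: coord_continuous.
  exact: exprn_continuous.
move=> x; apply: (continuous_comp (sqr_continuous x)).
exact: sqrt_continuous.
Qed.

(** * The boundary of the unit ball *)

(** A point z of the sphere is the limit of the points s z of the ball as s
   increases to 1. *)
Lemma frontier_eball (R : realType) (n : nat) :
  frontier (eball R n) = [set z | enorm z = 1].
Proof.
have open_ball : open (eball R n).
  apply: (@open_comp _ _ (fun z : 'rV[R]_n => enorm z) [set r | r < 1]).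
    by move=> z _; exact: enorm_continuous.
  exact: open_lt.
rewrite /frontier (interior_id _).1 //.
apply/seteqP; split => [z [clz /negP]|z /= z1].
  rewrite /eball /= -leNgt => z_ge1; apply/eqP; rewrite eq_le z_ge1 andbT.
  suff : [set v : 'rV[R]_n | enorm v <= 1] z by [].
  have closed_ball : closed [set v : 'rV[R]_n | enorm v <= 1].
    apply: (@closed_comp _ _ (fun v : 'rV[R]_n => enorm v) [set r | r <= 1]).
      by move=> v _; exact: enorm_continuous.
    exact: closed_le.
  move: closed_ball => /closure_id ->.
  by apply: closureS clz => v /= /ltW.
split; last by rewrite /eball /= z1 ltxx.
move=> B Bz.
have sz : s *: z @[s --> 1^'-] --> z.
  apply: cvg_at_left_filter; rewrite -[X in _ --> X]scale1r.
  exact: cvgZr_tmp.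
have : \forall s \near 1^'-, [/\ B (s *: z), s < 1 & 0 < s].
  near=> s; split; near: s.
  - exact: sz.
  - exact: nbhs_left_lt.
  - exact: nbhs_left_gt.
move=> /filter_ex[s [Bsz s1 s0]]; exists (s *: z); split => //.
by rewrite /eball /= enormZ z1 mulr1 gtr0_norm.
Unshelve. all: by end_near.
Qed.

(** The zero vector has every direction; [e1] provides one. *)
Lemma polar_decomposition (R : realType) (n : nat) (x : 'rV[R]_n) :
  (0 < n)%N -> exists2 e : 'rV[R]_n, enorm e = 1 & x = enorm x *: e.
Proof.
move=> n_gt0; have [x0|x_neq0] := eqVneq (enorm x) 0.
  by exists (e1 R n); [exact: enorm_e1 | rewrite x0 scale0r (enorm_eq0 x0)].
exists ((enorm x)^-1 *: x); last by rewrite scalerA divff // scale1r.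
by rewrite enormZ ger0_norm ?invr_ge0 ?enorm_ge0 // mulVf.
Qed.

Lemma dist_to_frontier_eball (R : realType) (n : nat) (x : 'rV[R]_n) :
  (0 < n)%N -> eball R n x ->
  dist_to x (frontier (eball R n)) = 1 - enorm x.
Proof.
move=> n_gt0 xB; rewrite /dist_to frontier_eball.
have lb : lbound [set enorm (x - z) | z in [set z | enorm z = 1]]
    (1 - enorm x).
  by move=> _ [z /= z1 <-]; rewrite -z1 lerB_enorm.
have [e e_unit xe] := polar_decomposition x n_gt0.
have xe_dist : enorm (x - e) = 1 - enorm x.
  rewrite {1}xe -{2}(scale1r e) -scalerBl enormZ e_unit mulr1 distrC.
  by rewrite gtr0_norm // subr_gt0.
apply/eqP; rewrite eq_le; apply/andP; split.
  by rewrite -xe_dist; apply: ge_inf; [exists (1 - enorm x) | exists e].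
by apply: lb_le_inf => //; exists (enorm (x - e)), e.
Qed.

(** * The metric of the unit ball *)

Lemma u_metric_eball (R : realType) (n : nat) (x y : 'rV[R]_n) :
  (0 < n)%N -> eball R n x -> eball R n y ->
  u_metric (eball R n) x y =
  2 * ln ((enorm (x - y) + Num.max (1 - enorm x) (1 - enorm y)) /
          Num.sqrt ((1 - enorm x) * (1 - enorm y))).
Proof. by move=> n0 xB yB; rewrite /u_metric !dist_to_frontier_eball. Qed.

Lemma u_metric_eball_antipodal (R : realType) (n : nat) (z : 'rV[R]_n) :
  (0 < n)%N -> eball R n z ->
  u_metric (eball R n) (- z) z =
  2 * ln ((2 + 2 * enorm z) / (2 - 2 * enorm z)).
Proof.
move=> n_gt0 zB; have NzB : eball R n (- z) by rewrite /eball /= enormN.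
rewrite u_metric_eball // enormN maxxx -expr2 sqrtr_sqr.
have z1 : 0 < 1 - enorm z by rewrite subr_gt0.
have -> : - z - z = - (2 *: z) by rewrite scaler_nat mulr2n opprD.
rewrite (gtr0_norm z1) enormN enormZ ger0_norm //; congr (2 * ln _).
field; lra.
Qed.

(** This is applied with a = 1 - |x|, b = 1 - |y| and t = |x - y|, for which
   the upper bound on t is the triangle inequality t <= |x| + |y|.  It holds
   because sqrt (a b) is at most both max a b and the mean of a and b. *)
Lemma ratio_ge (R : rcfType) (a b t : R) :
  0 < a -> 0 < b -> 0 <= t -> t <= 2 - a - b ->
  (2 + t) / (2 - t) <= (t + Num.max a b) / Num.sqrt (a * b).
Proof.
move=> a_gt0 b_gt0 t_ge0 tab.
have ab_gt0 : 0 < a * b by rewrite mulr_gt0.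
set s := Num.sqrt (a * b); have s_gt0 : 0 < s by rewrite sqrtr_gt0.
have s2 : s ^+ 2 = a * b by rewrite sqr_sqrtr // ltW.
have s_max : s <= Num.max a b.
  have aM : a <= Num.max a b by rewrite le_max lexx.
  have bM : b <= Num.max a b by rewrite le_max lexx orbT.
  rewrite -(@ler_pXn2r _ 2) ?nnegrE ?s2 ?expr2 ?(ltW s_gt0) //.
    by apply: ler_pM => //; exact: ltW.
  exact: le_trans (ltW a_gt0) aM.
have s_mean : 2 * s <= a + b.
  rewrite -(@ler_pXn2r _ 2) ?nnegrE ?addr_ge0 ?mulr_ge0
    ?(ltW a_gt0) ?(ltW b_gt0) ?(ltW s_gt0) //.
  rewrite exprMn s2 -subr_ge0.
  have -> : (a + b) ^+ 2 - 2 ^+ 2 * (a * b) = (a - b) ^+ 2 by ring.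
  exact: sqr_ge0.
have t_lt2 : 0 < 2 - t by lra.
have step_max : 0 <= (Num.max a b - s) * (2 - t) by apply: mulr_ge0; lra.
have step_mean : 0 <= t * (2 - t - 2 * s) by apply: mulr_ge0; lra.
rewrite ler_pdivrMr // mulrAC ler_pdivlMr //.
lra.
Qed.

Lemma le_2ln_ratio (R : realType) (t : R) : 0 <= t -> t < 2 ->
  t <= 2 * ln ((2 + t) / (2 - t)).
Proof.
move=> t_ge0 t_lt2.
have p_gt0 : 0 < 2 + t by lra.
have m_gt0 : 0 < 2 - t by lra.
set q := (2 - t) / (2 + t); have q_gt0 : 0 < q by rewrite divr_gt0.
have -> : (2 + t) / (2 - t) = q^-1 by rewrite invf_div.
rewrite lnV ?posrE //.
have ln_q : ln q <= q - 1.
  have -> : ln q = ln (1 + (q - 1)) by congr ln; ring.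
  by apply: le_ln1Dx; lra.
suff : t <= 2 * (1 - q) by lra.
have -> : 2 * (1 - q) = 4 * t / (2 + t) by rewrite /q; field; lra.
by rewrite ler_pdivlMr //; nra.
Qed.

Theorem theorem3p4 (R : realType) (n : nat) (n_gt0 : (0 < n)%N)
    (x y : 'rV[R]_n) (xB : eball R n x) (yB : eball R n y) :
  let w := (enorm (x - y) / 2) *: e1 R n in
  [/\ u_metric (eball R n) x y >= u_metric (eball R n) (- w) w,
      u_metric (eball R n) (- w) w
        = 2 * ln ((2 + enorm (x - y)) / (2 - enorm (x - y))),
      2 * ln ((2 + enorm (x - y)) / (2 - enorm (x - y))) >= enorm (x - y) &
      y = - x -> u_metric (eball R n) x y = u_metric (eball R n) (- w) w].
Proof.
move=> w; set t := enorm (x - y).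
have x_lt1 : enorm x < 1 by [].
have y_lt1 : enorm y < 1 by [].
have t_ge0 : 0 <= t by exact: enorm_ge0.
have t_le : t <= enorm x + enorm y by exact: ler_enormB.
have t_lt2 : t < 2 by lra.
have enorm_w : 2 * enorm w = t.
  rewrite enormZ enorm_e1 // mulr1 ger0_norm ?divr_ge0 //.
  by rewrite mulrC divfK.
have wB : eball R n w by rewrite /eball /=; lra.
have uw : u_metric (eball R n) (- w) w = 2 * ln ((2 + t) / (2 - t)).
  by rewrite u_metric_eball_antipodal // enorm_w.
split => //.
- have le_ratio : (2 + t) / (2 - t) <=
      (t + Num.max (1 - enorm x) (1 - enorm y)) /
      Num.sqrt ((1 - enorm x) * (1 - enorm y)) by apply: ratio_ge; lra.
  have ratio_gt0 : 0 < (2 + t) / (2 - t) by apply: divr_gt0; lra.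
  rewrite uw u_metric_eball // ler_pM2l // ler_ln ?posrE //.
  exact: lt_le_trans ratio_gt0 le_ratio.
- exact: le_2ln_ratio.
- move=> y_Nx; rewrite uw.
  have x_Ny : x = - y by rewrite y_Nx opprK.
  rewrite {1}x_Ny u_metric_eball_antipodal // /t x_Ny.
  have -> : - y - y = - (2 *: y) by rewrite scaler_nat mulr2n opprD.
  by rewrite enormN enormZ ger0_norm.
Qed.
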